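(* Let $E,Z$ be Banach spaces, $D$ a normed linear space, $X\subset E$ a closed convex set, $Y\subset D$ a set (the set of values of the discrete variable $y$), $K\subset Z$ a closed convex cone with nonempty interior, and let $f:X\times Y\to\mathbb{R}$, $g:X\times Y\to Z$ be such that, for each $y\in Y$, $f(\cdot,y)$ is convex and $g(\cdot,y)$ is $K$-convex on $X$. Let $V:=\{y\in Y:g(x,y)\preceq_K0\text{ for some }x\in X\}$. Assume that $g(\cdot,y)$ is continuous for every $y\in Y$ and that the Slater condition holds: for every $y\in V$ there is $\hat x\in X$ with $g(\hat x,y)\prec_K0$. Suppose that $X$ is compact, that $Y$ has finite cardinality, and that $f(\cdot,y)$ is continuous on $X$ for every fixed $y\in Y$. Then for any given $\varepsilon>0$, the generalized Benders decomposition algorithm (Algorithm 1, described in the context) for the problem of minimizing $f(x,y)$ subject to $g(x,y)\preceq_K0$, $x\in X$, $y\in Y$, terminates in a finite number of steps.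
   Context: Order notation: $z_1\preceq_K z_2$ means $z_2-z_1\in K$; $z_1\prec_K z_2$ means $z_2-z_1\in\mathrm{int}(K)$. A map $\varphi:X\to Z$ is $K$-convex if $\varphi(\lambda x_1+(1-\lambda)x_2)\preceq_K\lambda\varphi(x_1)+(1-\lambda)\varphi(x_2)$ for all $x_1,x_2\in X$, $\lambda\in[0,1]$. $K^+:=\{z^*\in Z^*:\langle z^*,z\rangle\ge0\ \forall z\in K\}$. For $y\in Y$, $P(y)$ is the problem: minimize $f(x,y)$ subject to $x\in X$, $g(x,y)\preceq_K0$, and $v_y(0):=\inf\{f(x,y):x\in X,\ g(x,y)\preceq_K0\}$ with $\inf\emptyset=+\infty$. $\bar u^*\in Z^*$ is an optimal Lagrange multiplier for $P(y)$ if there is $\bar x\in X$ such that: (i) $f(\bar x,y)+\langle\bar u^*,g(\bar x,y)\rangle=\min_{x\in X}\{f(x,y)+\langle\bar u^*,g(x,y)\rangle\}$; (ii) $\langle\bar u^*,g(\bar x,y)\rangle=0$; (iii) $\bar u^*\in K^+$; (iv) $g(\bar x,y)\preceq_K0$. Algorithm 1, with tolerance $\varepsilon>0$. Step 1: Take $y_1\in V$ and $z_1^*\in K^+$ with $\|z_1^*\|=1$. Solve $P(y_1)$ and obtain an optimal Lagrange multiplier $u_1^*$ of $P(y_1)$. Set $T^1=S^1:=\{1\}$, $\mathrm{UBD}^1:=v_{y_1}(0)$, $k:=1$. Step 2: Let $(y_{k+1},\eta_{k+1})$ be an optimal solution of the relaxed master problem: minimize $\eta$ over $y\in Y$, $\eta\in\mathbb{R}$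 subject to $\eta\ge\inf_{x\in X}\{f(x,y)+\langle u_i^*,g(x,y)\rangle\}$ for all $i\in T^k$ and $\inf_{x\in X}\langle z_j^*,g(x,y)\rangle\le0$ for all $j\in S^k$. If $\mathrm{UBD}^k\le\eta_{k+1}+\varepsilon$, terminate; otherwise go to Step 3. Step 3: Solve $P(y_{k+1})$. (a) If $v_{y_{k+1}}(0)<+\infty$: if $v_{y_{k+1}}(0)\le\eta_{k+1}+\varepsilon$, terminate; otherwise determine an optimal Lagrange multiplier $u_{k+1}^*$ of $P(y_{k+1})$, and let $T^{k+1}:=T^k\cup\{k+1\}$, $S^{k+1}:=S^k$, $\mathrm{UBD}^{k+1}:=\min\{\mathrm{UBD}^k,v_{y_{k+1}}(0)\}$. Set $k:=k+1$ and return to Step 2. (b) If $v_{y_{k+1}}(0)=+\infty$ (i.e. $P(y_{k+1})$ is infeasible): take $z_{k+1}^*\in K^+$ with $\|z_{k+1}^*\|=1$ and $\inf_{x\in X}\langle z_{k+1}^*,g(x,y_{k+1})\rangle>0$; let $T^{k+1}:=T^k$, $S^{k+1}:=S^k\cup\{k+1\}$, $\mathrm{UBD}^{k+1}:=\mathrm{UBD}^k$. Set $k:=k+1$ and return to Step 2. ''Terminates in a finite number of steps'' means that every execution of the algorithm, whatever admissible choices are made, stops after finitely many iterations. *)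

(* Defs.v *)
From HB Require Import structures.
From mathcomp Require Import all_boot all_order all_algebra.
From mathcomp Require Import all_classical all_reals all_analysis.

Set Implicit Arguments.
Unset Strict Implicit.
Unset Printing Implicit Defensive.

Import Order.TTheory GRing.Theory Num.Theory.
Import numFieldNormedType.Exports.

Local Open Scope classical_set_scope.
Local Open Scope ring_scope.

Section DualSpace.
Context {R : realType} {Z : normedModType R}.

Record dual_space := DualSpace {
  dual_fun :> {linear Z -> R^o} ;
  dual_continuous : continuous dual_fun }.

(* The set below is nonempty, and bounded because the functional is continuous,
   so this real supremum is the usual dual norm. *)
Definition dual_norm (u : dual_space) : R :=
  sup [set `|u z| | z in [set z : Z | `|z| <= 1]].

End DualSpace.
Arguments dual_space {R} Z.

Section ConeOrder.
Context {R : realType} {E Z : normedModType R}.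
Variable K : set Z.

Definition cone : Prop := forall (t : R) (z : Z), 0 <= t -> K z -> K (t *: z).

Definition preceq (z1 z2 : Z) : Prop := K (z2 - z1).

Definition prec (z1 z2 : Z) : Prop := interior K (z2 - z1).

Definition cone_convex (X : set E) (phi : E -> Z) : Prop :=
  forall (x1 x2 : E) (lambda : R), X x1 -> X x2 -> 0 <= lambda <= 1 ->
    preceq (phi (lambda *: x1 + (1 - lambda) *: x2))
           (lambda *: phi x1 + (1 - lambda) *: phi x2).

(* K^+ *)
Definition dual_cone : set (dual_space Z) :=
  [set u | forall z, K z -> 0 <= u z].

End ConeOrder.

Section GeneralizedBenders.
Context {R : realType} {E Z D : normedModType R}.
(* f and g are total functions; only their values on X x Y are ever used. *)
Variables (X : set E) (Y : set D) (K : set Z).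
Variables (f : E -> D -> R) (g : E -> D -> Z).

Definition feasible_set (y : D) : set E := [set x | X x /\ preceq K (g x y) 0].

Definition feasible_params : set D := [set y | Y y /\ feasible_set y !=set0].

(* v_y(0); ereal_inf set0 = +oo *)
Definition value (y : D) : \bar R :=
  ereal_inf [set (f x y)%:E | x in feasible_set y].

Definition optimal_multiplier (y : D) (u : dual_space Z) : Prop :=
  exists2 xbar, X xbar &
    [/\ forall x, X x -> f xbar y + u (g xbar y) <= f x y + u (g x y),
        u (g xbar y) = 0,
        dual_cone K u
      & preceq K (g xbar y) 0].

Definition lagrangian_inf (u : dual_space Z) (y : D) : \bar R :=
  ereal_inf [set (f x y + u (g x y))%:E | x in X].

Definition constraint_inf (z : dual_space Z) (y : D) : \bar R :=
  ereal_inf [set (z (g x y))%:E | x in X].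

(* Data available after the k-th pass: the index sets T^k and S^k, the
   multipliers (u_i)_i and (z_j)_j, and UBD^k. The values u_i for i \notin T^k
   and z_j for j \notin S^k are irrelevant. *)
Record gbd_state := GbdState {
  gbd_k : nat ;
  gbd_T : set nat ;
  gbd_S : set nat ;
  gbd_u : nat -> dual_space Z ;
  gbd_z : nat -> dual_space Z ;
  gbd_UBD : \bar R }.

Definition gbd_initial (y1 : D) (u1 z1 : dual_space Z) : gbd_state :=
  GbdState 1 [set 1%N] [set 1%N] (fun=> u1) (fun=> z1) (value y1).

Definition add_optimality_cut (s : gbd_state) (y : D) (u : dual_space Z) :=
  GbdState (gbd_k s).+1 (gbd_T s `|` [set (gbd_k s).+1]) (gbd_S s)
    (fun i => if i == (gbd_k s).+1 then u else gbd_u s i) (gbd_z s)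
    (Order.min (gbd_UBD s) (value y)).

Definition add_feasibility_cut (s : gbd_state) (z : dual_space Z) :=
  GbdState (gbd_k s).+1 (gbd_T s) (gbd_S s `|` [set (gbd_k s).+1])
    (gbd_u s) (fun j => if j == (gbd_k s).+1 then z else gbd_z s j)
    (gbd_UBD s).

Definition master_feasible (s : gbd_state) (y : D) (eta : R) : Prop :=
  [/\ Y y,
      forall i, gbd_T s i -> (lagrangian_inf (gbd_u s i) y <= eta%:E)%E
    & forall j, gbd_S s j -> (constraint_inf (gbd_z s j) y <= 0)%E].

Definition master_optimal (s : gbd_state) (y : D) (eta : R) : Prop :=
  master_feasible s y eta /\
  forall y' eta', master_feasible s y' eta' -> eta <= eta'.

(* Control points of the algorithm: Step1 y1 z1 is Step 1 after the choice of
   y1 and z1, Step3 s y eta is Step 3 with (y_{k+1}, eta_{k+1}) = (y, eta), and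
   Stopped is reached only by executing a terminate instruction. *)
Inductive gbd_config :=
  | Step1 of D & dual_space Z
  | Step2 of gbd_state
  | Step3 of gbd_state & D & R
  | Stopped.

Inductive gbd_step (eps : R) : gbd_config -> gbd_config -> Prop :=
  | step_init y1 z1 u1 :
      optimal_multiplier y1 u1 ->
      gbd_step eps (Step1 y1 z1) (Step2 (gbd_initial y1 u1 z1))
  | step_master_stop s y eta :
      master_optimal s y eta ->
      (gbd_UBD s <= (eta + eps)%:E)%E ->
      gbd_step eps (Step2 s) Stopped
  | step_master s y eta :
      master_optimal s y eta ->
      ~ (gbd_UBD s <= (eta + eps)%:E)%E ->
      gbd_step eps (Step2 s) (Step3 s y eta)
  | step_primal_stop s y eta :
      (value y < +oo)%E ->
      (value y <= (eta + eps)%:E)%E ->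
      gbd_step eps (Step3 s y eta) Stopped
  | step_primal s y eta u :
      (value y < +oo)%E ->
      ~ (value y <= (eta + eps)%:E)%E ->
      optimal_multiplier y u ->
      gbd_step eps (Step3 s y eta) (Step2 (add_optimality_cut s y u))
  | step_infeasible s y eta z :
      value y = +oo%E ->
      dual_cone K z ->
      dual_norm z = 1 ->
      (0 < constraint_inf z y)%E ->
      gbd_step eps (Step3 s y eta) (Step2 (add_feasibility_cut s z)).

(* Maximal executions, with a configuration that has no successor repeated
   forever. *)
Definition gbd_execution (eps : R) (c : nat -> gbd_config) : Prop :=
  forall n, gbd_step eps (c n) (c n.+1) \/
    (c n.+1 = c n /\ forall c', ~ gbd_step eps (c n) c').

(* Every execution, whatever choices are made, executes a terminate instruction
   after finitely many steps; in particular it neither runs forever nor gets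
   stuck because some required object does not exist. *)
Definition gbd_terminates (eps : R) : Prop :=
  forall (y1 : D) (z1 : dual_space Z),
    feasible_params y1 -> dual_cone K z1 -> dual_norm z1 = 1 ->
  forall c : nat -> gbd_config,
    c 0%N = Step1 y1 z1 -> gbd_execution eps c -> exists n, c n = Stopped.

End GeneralizedBenders.

(* Main.v *)
(* Step 3 is left without termination at most once for each parameter y.
   If P(y) is feasible, its optimal multiplier u satisfies
   inf_x {f(x, y) + <u, g(x, y)>} = v_y(0), so the optimality cut forces
   eta >= v_y(0) whenever y returns and Step 3 terminates; if P(y) is
   infeasible, the feasibility cut excludes y.

   That no execution gets stuck rests on separation. A maximal convex cone A
   avoiding - e satisfies A \cup - A = W; if e is an order unit, then
   w |-> sup {t | w - t e \in A} is linear. Applied in Z to K and g(X, y) - d e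
   this yields the multipliers of infeasible problems (compactness provides the
   margin d > 0 that makes the separation strict), and applied in Z * R to
   K * R_+ and the pairs (g(x, y), f(x, y) - v_y(0)) it yields those of the
   feasible ones. Continuity is automatic: a functional nonnegative on a cone
   with nonempty interior is bounded. *)

Require Import Defs.
From HB Require Import structures.
From mathcomp Require Import all_boot all_order all_algebra.
From mathcomp Require Import all_classical all_reals all_analysis.
From mathcomp Require Import lra ring.

Set Implicit Arguments.
Unset Strict Implicit.
Unset Printing Implicit Defensive.

Import Order.TTheory GRing.Theory Num.Theory.
Import numFieldNormedType.Exports.

Local Open Scope classical_set_scope.
Local Open Scope ring_scope.

(** * Separation of a point from a convex cone in a real vector space *)

Section ConeSeparation.
Context {R : realType} {W : lmodType R}.
Implicit Types (A C : set W) (e v w : W) (r s t d : R).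

Definition convex_cone C : Prop :=
  [/\ C 0, forall t w, 0 <= t -> C w -> C (t *: w)
    & forall v w, C v -> C w -> C (v + w)].

(** If a maximal [A] contained neither [w] nor [- w], adjoining either would produce [- e], say
    [- e = a + t w = b - s w]. Then [s a + t b = - (s + t) e] no longer involves [w] and puts [- e]
    in [A]. *)
Lemma total_cone_extension C e : convex_cone C -> ~ C (- e) ->
  exists A, [/\ convex_cone A, C `<=` A, ~ A (- e) & forall w, A w \/ A (- w)].
Proof.
move=> [C0 Cz Cd] Ce.
(* These conditions are phrased so that set0, the union of the empty chain,
   satisfies them. *)
pose G : set (set W) := [set A | [/\ forall t w, 0 <= t -> A w -> A (t *: w),
  forall v w, A v -> A w -> A (v + w),
  forall v w, A v -> C w -> A (v + w) & ~ A (- e)]].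
have [F FG Ftot|A [[Az Ad AC Ae] Amax]] := @Zorn_bigcup _ G.
  split.
  - by move=> t w t0 [B FB Bw]; exists B => //;
      have [+ _ _ _] := FG _ FB; apply.
  - move=> v w [B FB Bv] [B' FB' Bw].
    have [BB'|BB'] := Ftot _ _ FB FB'.
      by exists B' => //; have [_ + _ _] := FG _ FB'; apply => //; exact: BB'.
    by exists B => //; have [_ + _ _] := FG _ FB; apply => //; exact: BB'.
  - by move=> v w [B FB Bv] Cw; exists B => //;
      have [_ _ + _] := FG _ FB; apply.
  - by move=> [B FB]; have [_ _ _] := FG _ FB.
(* The maximal set is not empty, since otherwise [C] would be a strictly larger member of [G]. *)
have A0 : A 0.
  have [a Aa] : exists a, A a.
    apply: contrapT => A0; apply: (Amax C) => //; split.
      by move=> a Aa; exfalso; apply: A0; exists a.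
    by move=> CA; apply: A0; exists 0; exact: CA.
  by rewrite -(scale0r a); exact: Az.
have CA : C `<=` A by move=> c Cc; rewrite -[c]add0r; exact: AC.
(* The cone [A + R_+ w] strictly contains [A], so by maximality it fails to be in [G] and must
   contain [- e]. *)
have extend w : ~ A w -> exists a t, [/\ A a, 0 <= t & - e = a + t *: w].
  move=> Aw; apply: contrapT => nex.
  apply: (Amax [set b | exists a t, [/\ A a, 0 <= t & b = a + t *: w]]).
    split=> [a Aa|BA]; first by exists a, 0; rewrite scale0r addr0.
    by apply/Aw/BA; exists 0, 1; rewrite scale1r add0r.
  split.
  - move=> t _ t0 [a [s [Aa s0 ->]]]; exists (t *: a), (t * s).
    by rewrite scalerDr scalerA mulr_ge0//; split => //; exact: Az.
  - move=> _ _ [a [s [Aa s0 ->]]] [b [t [Ab t0 ->]]]; exists (a + b), (s + t).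
    by rewrite scalerDl addrACA addr_ge0//; split => //; exact: Ad.
  - move=> _ c [a [s [Aa s0 ->]]] Cc; exists (a + c), s.
    by rewrite addrAC; split => //; exact: AC.
  - exact: nex.
exists A; split => // w; apply: contrapT => /not_orP[/extend[a [t [Aa t0 ea]]]].
move=> /extend[b [s [Ab s0 eb]]]; apply: Ae.
have [t00|tn0] := eqVneq t 0; first by rewrite ea t00 scale0r addr0.
have ts : 0 < t + s by rewrite ltr_pwDl// lt_def tn0.
have -> : - e = (t + s)^-1 *: (s *: a + t *: b).
  have -> : a = - e - t *: w by rewrite ea addrK.
  have -> : b = - e + s *: w by rewrite eb scalerN subrK.
  rewrite (scalerDr s) (scalerDr t) (scalerN _ (t *: w)) !scalerA (mulrC s).
  rewrite addrACA addNr addr0 -scalerDl scalerA addrC mulVf ?scale1r//.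
  by rewrite addrC gt_eqF.
  apply: (Az); first by rewrite invr_ge0 ltW.
  by apply: Ad; exact: Az.
Qed.

(** The order unit makes the supremum defining [phi] finite; the totality of [A] makes the lower
    bound that it gives an upper bound as well, so superadditivity becomes additivity. *)
Lemma cone_separation C e : convex_cone C ->
  (forall w, exists2 s, 0 < s & C (e + s *: w)) -> ~ C (- e) ->
  exists phi : {linear W -> R^o}, phi e = 1 /\ forall w, C w -> 0 <= phi w.
Proof.
move=> Ccone unit /(total_cone_extension Ccone)[A [[A0 Az Ad] CA Ae Atot]].
(* Every comparison of reals below comes from this: [A] contains no negative multiple of [e]. *)
have AeP r : A (r *: e) -> 0 <= r.
  rewrite leNgt => Ar; apply/negP => r0; apply: Ae.
  have -> : - e = - r^-1 *: (r *: e).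
    by rewrite scalerA mulNr mulVf ?lt_eqF// scaleN1r.
  by apply: Az => //; rewrite oppr_ge0 invr_le0 ltW.
have Ae1 : A e by have [s _] := unit 0; rewrite scaler0 addr0 => /CA.
have unitA w : exists s, A (w + s *: e).
  have [s s0 /CA /(Az s^-1)] := unit w; rewrite invr_ge0 ltW// => /(_ isT).
  by rewrite scalerDr scalerA mulVf ?gt_eqF// scale1r addrC => ?; exists s^-1.
(* Q w r amounts to r <= sup {t | w - t e \in A}, and Q (- w) (- r) to the
   reverse inequality. *)
pose Q w r := forall d, 0 < d -> A (w + (d - r) *: e).
have QD v w r s : Q v r -> Q w s -> Q (v + w) (r + s).
  move=> Qv Qw d d0; have d20 : 0 < d / 2 by rewrite divr_gt0.
  have := Ad _ _ (Qv _ d20) (Qw _ d20); rewrite addrACA -scalerDl.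
  by congr (A (_ + _ *: _)); lra.
have QZ a w r : 0 < a -> Q w r -> Q (a *: w) (a * r).
  move=> a0 Qw d d0; have da : 0 < d / a by rewrite divr_gt0.
  have := Az _ _ (ltW a0) (Qw _ da); rewrite scalerDr scalerA.
  by congr (A (_ + _ *: _)); field; rewrite gt_eqF.
have Qle w r s : Q w r -> Q (- w) (- s) -> r <= s.
  move=> Qw Qw'; apply/ler_addgt0Pr => d d0.
  have := QD _ _ _ _ Qw Qw' d d0; rewrite subrr add0r => /AeP; lra.
pose phi w := sup [set t | A (w + (- t) *: e)].
have phi_sup w : has_sup [set t | A (w + (- t) *: e)].
  split; first by have [s As] := unitA w; exists (- s); rewrite /= opprK.
  have [s As] := unitA (- w); exists s => t /= At.
  have := Ad _ _ As At; rewrite addrACA addNr add0r -scalerDl => /AeP; lra.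
have phiQ w : Q w (phi w).
  move=> d d0; have [t At] := sup_adherent d0 (phi_sup w).
  rewrite -/(phi w) => dt.
  have -> : w + (d - phi w) *: e = w + (- t) *: e + (d - phi w + t) *: e.
    by rewrite -addrA -scalerDl; congr (_ + _ *: _); lra.
  by apply: Ad => //; apply: Az => //; lra.
(* Totality enters here: were this vector not in [A], its opposite [w - (d + phi w) e] would be,
   against the supremum. *)
have phiNQ w : Q (- w) (- phi w).
  move=> d d0; have [//|] := Atot (- w + (d - - phi w) *: e).
  rewrite opprD opprK -scaleNr => At.
  by have := sup_upper_bound (phi_sup w) At; rewrite -/(phi w); lra.
have phiE w r : Q w r -> Q (- w) (- r) -> phi w = r.
  by move=> Qw Qw'; apply/eqP; rewrite eq_le !(Qle w).
have phi0 : phi 0 = 0.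
  apply: phiE => d d0; rewrite !oppr0 add0r addr0;
    by apply: Az => //; exact: ltW.
have phiD v w : phi (v + w) = phi v + phi w.
  by apply: phiE; rewrite ?opprD; exact: QD.
have phiN w : phi (- w) = - phi w by apply: phiE; rewrite ?opprK.
have phiZ_gt0 a w : 0 < a -> phi (a *: w) = a * phi w.
  by move=> a0; apply: phiE; rewrite -?scalerN -?mulrN; exact: QZ.
have phiZ a w : phi (a *: w) = a * phi w.
  have [a0|a0|->] := ltgtP a 0; last by rewrite scale0r mul0r.
    by rewrite -{1}[a]opprK scaleNr phiN phiZ_gt0 ?oppr_gt0// mulNr opprK.
  exact: phiZ_gt0.
have phi_e : phi e = 1.
  apply: phiE => d d0.
    rewrite -[X in X + _]scale1r -scalerDl; apply: Az => //; lra.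
  rewrite -scaleN1r -scalerDl; apply: Az => //; lra.
have phi_ge0 w : A w -> 0 <= phi w.
  move=> Aw; apply: (sup_upper_bound (phi_sup w)).
  by rewrite /= oppr0 scale0r addr0.
have phi_lin : linear (phi : W -> R^o) by move=> a v w; rewrite phiD phiZ.
pose phiL := GRing.isLinear.Build R W R^o _ (phi : W -> R^o) phi_lin.
pose phi' : {linear W -> R^o} := HB.pack (phi : W -> R^o) phiL.
by exists phi'; split => // w /CA; exact: phi_ge0.
Qed.

End ConeSeparation.

(** * Separation of a set that is convex modulo a cone *)

Section ConvexSeparation.
Context {R : realType} {W : lmodType R}.
Variables (K A : set W) (e : W).
Hypothesis K_cone : convex_cone K.
Hypothesis e_unit : forall w, exists2 s : R, 0 < s & K (e + s *: w).
Hypothesis A_nonempty : A !=set0.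
Hypothesis A_convex : forall a b (t : R), A a -> A b -> 0 <= t <= 1 ->
  exists2 c, A c & K (t *: a + (1 - t) *: b - c).
Hypothesis A_disjoint : forall a (t : R), A a -> 0 < t -> ~ K (- (a + t *: e)).

(** This is [K + R_+ A]. The set [A] is convex only up to elements of [K], as the image of a
    [K]-convex map is; the summand [K] absorbs the defect, so that sums stay in [C]. *)
Let C : set W := [set w | exists s a, [/\ 0 <= s, A a & K (w - s *: a)]].

Let C_cone : convex_cone C.
Proof.
have [K0 Kz Kd] := K_cone; have [a0 Aa0] := A_nonempty; split.
- by exists 0, a0; rewrite scale0r subr0.
- move=> t w t0 [s [a [s0 Aa Kw]]]; exists (t * s), a; split => //.
    exact: mulr_ge0.
  by rewrite -scalerA -scalerBr; exact: Kz.
- move=> v w [s [a [s0 Aa Kv]]] [r [b [r0 Ab Kw]]].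
  have [sr0|sr_neq0] := eqVneq (s + r) 0.
    have [s00 r00] : s = 0 /\ r = 0 by lra.
    exists 0, a; split => //; rewrite scale0r subr0.
    move: Kv Kw; rewrite s00 r00 !scale0r !subr0; exact: Kd.
  have sr : 0 < s + r by rewrite lt_def sr_neq0 addr_ge0.
  have t01 : 0 <= s / (s + r) <= 1.
    by rewrite divr_ge0 ?addr_ge0//= ler_pdivrMr// mul1r lerDl.
  have [c Ac /(Kz (s + r) _ (ltW sr))] := A_convex Aa Ab t01.
  rewrite scalerBr scalerDr !scalerA.
  have -> : (s + r) * (s / (s + r)) = s by rewrite mulrC divfK.
  have -> : (s + r) * (1 - s / (s + r)) = r.
    by rewrite mulrBr mulr1 [_ * (s / _)]mulrC divfK// addrAC subrr add0r.
  move=> Kc; exists (s + r), c; split => //; first exact: ltW.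
  have -> : v + w - (s + r) *: c =
      (v - s *: a) + (w - r *: b) + (s *: a + r *: b - (s + r) *: c).
    by rewrite addrA [_ + _ + (w - _)]addrACA -opprD subrK.
  by apply: (Kd) => //; exact: Kd.
Qed.

Lemma convex_separation : exists phi : {linear W -> R^o},
  [/\ phi e = 1, forall w, K w -> 0 <= phi w & forall a, A a -> 0 <= phi a].
Proof.
have [K0 Kz Kd] := K_cone; have [a0 Aa0] := A_nonempty.
have KC : K `<=` C by move=> w Kw; exists 0, a0; rewrite scale0r subr0.
have unit w : exists2 s, 0 < s & C (e + s *: w).
  by have [s s0 /KC] := e_unit w; exists s.
have [|phi [phie phi0]] := cone_separation C_cone unit.
  move=> [s [a [s0 Aa]]]; rewrite -opprD; have [->|sn0] := eqVneq s 0.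
    (* With [- e] in [K], the order unit [e] forces [K] to be the whole space, which [A_disjoint]
       rules out. *)
    rewrite scale0r addr0 => Ke.
    apply: (A_disjoint Aa ltr01); move: (- (a + _)) => b.
    have [t t0 Kb] := e_unit b; have tn0 : t != 0 by rewrite gt_eqF.
    rewrite -[b](scalerK tn0) -[_ *: b](addKr e).
    by apply: (Kz); [rewrite invr_ge0 ltW|exact: Kd].
  have {}s0 : 0 < s by rewrite lt_def sn0.
  move=> /(Kz s^-1); rewrite scalerN scalerDr scalerA mulVf// scale1r addrC.
  by rewrite invr_ge0 ltW// => /(_ isT); apply: A_disjoint; rewrite ?invr_gt0.
exists phi; split => // [w /KC|a Aa]; first exact: phi0.
by apply: phi0; exists 1, a; rewrite scale1r subrr.
Qed.

End ConvexSeparation.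

(** * Order units, automatic continuity and the dual norm *)

Section DualSpaceFacts.
Context {R : realType} {Z : normedModType R}.
Implicit Types (K : set Z) (e w z : Z) (u : dual_space Z).

Lemma interior_order_unit K e w :
  interior K e -> exists2 s : R, 0 < s & K (e + s *: w).
Proof.
move=> /nbhs_normP[d /= d0 dK]; have w0 : 0 < `|w| + 1 by rewrite ltr_wpDl.
exists (d / (`|w| + 1)); first by rewrite divr_gt0.
apply: dK => /=; rewrite opprD addNKr normrN normrZ ger0_norm ?divr_ge0 ?ltW//.
by rewrite mulrAC ltr_pdivrMr// ltr_pM2l// ltrDl.
Qed.

(** For small [z] both [e + z] and [e - z] lie in [K], whence [|phi z| <= phi e]. *)
Lemma positive_linear_continuous K e (phi : {linear Z -> R^o}) :
  interior K e -> (forall z, K z -> 0 <= phi z) -> continuous phi.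
Proof.
move=> /nbhs_normP[d /= d0 dK] phi0; apply: bounded_linear_continuous.
apply/ex_bound; exists (phi e); apply/nbhs_norm0P; exists d => //= z /= zd.
have : 0 <= phi (e + z) by apply/phi0/dK; rewrite /= opprD addNKr normrN.
have : 0 <= phi (e - z) by apply/phi0/dK; rewrite /= opprB addrC subrK.
by rewrite linearB linearD /= ler_norml => ? ?; apply/andP; split; lra.
Qed.

Lemma dual_scale u c : exists u' : dual_space Z, forall z, u' z = c * u z.
Proof.
have lin : linear ((fun z => c * u z) : Z -> R^o).
  by move=> a v w /=; rewrite linearP /= mulrDr mulrCA.
pose uL := GRing.isLinear.Build R Z R^o _ ((fun z => c * u z) : Z -> R^o) lin.
pose u' : {linear Z -> R^o} := HB.pack ((fun z => c * u z) : Z -> R^o) uL.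
have u'c : continuous u'.
  by move=> z; apply: cvgM; [exact: cvg_cst|exact: dual_continuous].
by exists (DualSpace u'c).
Qed.

Lemma dual_norm_has_sup u :
  has_sup [set `|u z| | z in [set z : Z | `|z| <= 1]].
Proof.
split; first by exists `|u 0|, 0 => //=; rewrite normr0.
have /linear_bounded_continuous/linear_boundedP/pinfty_ex_gt0[M M0 uM] :=
  @dual_continuous _ _ u.
exists M => _ [z /= z1 <-]; apply: (le_trans (uM z)).
by rewrite ler_piMr// ltW.
Qed.

(** Provides the unit norm required of a feasibility multiplier; the factor is positive, so sign
    conditions survive. *)
Lemma dual_normalize u z0 : u z0 != 0 -> exists2 u' : dual_space Z,
  dual_norm u' = 1 & exists2 c : R, 0 < c & forall z, u' z = c * u z.
Proof.
move=> uz0; have supu := dual_norm_has_sup u.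
have z00 : 0 < `|z0|.
  by rewrite normr_gt0; apply: contra_neq uz0 => ->; rewrite linear0.
have N0 : 0 < dual_norm u.
  apply: (@lt_le_trans _ _ `|u (`|z0|^-1 *: z0)|).
    by rewrite normr_gt0 linearZ /= mulf_neq0// invr_neq0// gt_eqF.
  apply: sup_upper_bound => //; exists (`|z0|^-1 *: z0) => //=.
  by rewrite normrZ normfV normr_id mulVf// gt_eqF.
have [u' u'E] := dual_scale u (dual_norm u)^-1; exists u'; last first.
  by exists (dual_norm u)^-1; rewrite ?invr_gt0.
have supu' := dual_norm_has_sup u'.
apply/eqP; rewrite eq_le; apply/andP; split.
  apply: ge_sup; first by case: supu'.
  move=> _ [z z1 <-]; rewrite u'E normrM gtr0_norm ?invr_gt0//.
  by rewrite mulrC ler_pdivrMr// mul1r; apply: sup_upper_bound => //; exists z.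
rewrite -(ler_pM2l N0) mulr1; apply: ge_sup; first by case: supu.
move=> _ [z z1 <-]; rewrite mulrC -ler_pdivrMr// mulrC.
apply: sup_upper_bound => //; exists z => //.
by rewrite u'E normrM gtr0_norm// invr_gt0.
Qed.

End DualSpaceFacts.

(** * Duality for a single convex program *)

Section ConvexProgram.
Context {R : realType} {E Z : normedModType R}.
Implicit Types (X : set E) (K : set Z).

Lemma convex_setP {M : lmodType R} (A : set M) (a b : M) (t : R) :
  convex_set A -> A a -> A b -> 0 <= t <= 1 -> A (t *: a + (1 - t) *: b).
Proof.
move=> cA Aa Ab /andP[t0 t1].
by have := cA a b (Itv01 t0 t1) (mem_set Aa) (mem_set Ab); rewrite inE.
Qed.

Lemma convex_functionP {M : lmodType R} (A : set M) (h : M -> R^o)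
    (a b : M) (t : R) :
  convex_function A h -> A a -> A b -> 0 <= t <= 1 ->
  h (t *: a + (1 - t) *: b) <= t * h a + (1 - t) * h b.
Proof.
move=> ch Aa Ab /andP[t0 t1].
exact: (ch (Itv01 t0 t1) a b (mem_set Aa) (mem_set Ab)).
Qed.

(** A sum is twice a midpoint. *)
Lemma convex_cone_set K : K !=set0 -> convex_set K -> cone K -> convex_cone K.
Proof.
move=> [k Kk] cK Kz; split => // [|v w Kv Kw].
  by rewrite -(scale0r k); exact: Kz.
pose t : R := 2^-1; have t01 : 0 <= t <= 1 by rewrite /t; lra.
have /(Kz 2 _ (ler0n _ _)) := convex_setP cK Kv Kw t01.
have <- : t = 1 - t by rewrite /t; lra.
by rewrite -scalerDr scalerA divff// scale1r.
Qed.

Variables (X : set E) (K : set Z) (h : E -> Z).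
Hypothesis X_nonempty : X !=set0.
Hypothesis X_convex : convex_set X.
Hypothesis K_cone : convex_cone K.
Hypothesis h_convex : cone_convex K X h.

(** Since [K] is closed, [d e - h x'] stays outside [K] for [x'] near [x] and small [d > 0];
    compactness of [X] makes [d] uniform. *)
Lemma infeasibility_margin (e : Z) : compact X -> closed K ->
  {within X, continuous h} -> (forall x, X x -> ~ K (- h x)) ->
  exists2 d : R, 0 < d & forall x, X x -> ~ K (d *: e - h x).
Proof.
move=> /compact_near_coveringP/near_covering_withinP cX clK ch nK.
suff : \forall d \near (0 : R)^'+, X `<=` [set x | ~ K (d *: e - h x)].
  move=> H; near (0 : R)^'+ => d; exists d => // x Xx.
  by apply: (near H d).
apply: cX => x Xx.
have /subspace_continuousP/(_ x Xx) hx := ch.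
have /nbhs_normP[r /= r0 rK] : nbhs (- h x) (~` K).
  by apply: open_nbhs_nbhs; split; [exact: closed_openC|exact: nK].
have r20 : 0 < r / 2 by rewrite divr_gt0.
(* Half of the radius pays for the variation of [h], half for the shift by [d e]. *)
exists ([set x' | X x' -> `|h x - h x'| < r / 2], [set d | `|d *: e| < r / 2]).
  split => /=.
    by move/cvgrPdist_lt : hx => /(_ _ r20).
  have e0 : 0 < `|e| + 1 by rewrite ltr_wpDl.
  near=> d; rewrite /= normrZ gtr0_norm//.
  apply: (@le_lt_trans _ _ (d * (`|e| + 1))); first by rewrite ler_pM2l// lerDl.
  rewrite -ltr_pdivlMr//; near: d; apply: nbhs_right_lt; exact: divr_gt0.
move=> [x' d] /= [hx' de] Xx'; apply: rK => /=.
have -> : - h x - (d *: e - h x') = - (h x - h x') - d *: e.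
  by rewrite opprB opprD opprK addrA.
rewrite (le_lt_trans (ler_normB _ _))// normrN.
by have := hx' Xx'; lra.
Unshelve. all: by end_near. Qed.

Lemma infeasibility_certificate : compact X -> closed K -> interior K !=set0 ->
  {within X, continuous h} -> (forall x, X x -> ~ K (- h x)) ->
  exists u : dual_space Z, [/\ dual_cone K u, dual_norm u = 1
    & exists2 d : R, 0 < d & forall x, X x -> d <= u (h x)].
Proof.
move=> cX clK [e Ke] ch nK.
have [d d0 nKd] := infeasibility_margin e cX clK ch nK.
have [K0 Kz Kd] := K_cone; have [x0 Xx0] := X_nonempty.
have eK : K e by exact: interior_subset.
(* As [phi e = 1], nonnegativity on the shifted image reads [phi (h x) >= d], a bound uniform in
   [x]. *)
pose A := [set h x - d *: e | x in X].
have [| | |phi [phie phiK phiA]] :=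
    convex_separation (A := A) K_cone (fun w => interior_order_unit w Ke).
- by exists (h x0 - d *: e), x0.
- move=> _ _ t [x Xx <-] [y Xy <-] t01.
  exists (h (t *: x + (1 - t) *: y) - d *: e).
    by exists (t *: x + (1 - t) *: y) => //; exact: convex_setP.
  have := h_convex Xx Xy t01; rewrite /preceq; congr (K _).
  rewrite !scalerBr addrACA -opprD -scalerDl [t + _]addrC subrK scale1r.
  by rewrite opprB addrA subrK.
- move=> _ t [x Xx <-] t0 Kxt; apply: (nKd x Xx).
  have := Kd _ _ Kxt (Kz t _ (ltW t0) eK).
  by rewrite opprD addrNK opprB.
have [u uE] : exists u : dual_space Z, forall z, u z = phi z.
  by exists (DualSpace (positive_linear_continuous Ke phiK)).
have [|u' u'1 [c c0 u'E]] := @dual_normalize _ _ u e.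
  by rewrite uE phie oner_eq0.
exists u'; split => //.
  by move=> z zK; rewrite u'E uE; apply: mulr_ge0; [exact: ltW|exact: phiK].
exists (c * d); first exact: mulr_gt0.
move=> x Xx; rewrite u'E uE ler_pM2l//.
have : 0 <= phi (h x - d *: e) by apply: phiA; exists x.
by rewrite linearB linearZ /= phie /GRing.scale /= mulr1 subr_ge0.
Qed.


(** Separation in [Z * R] yields a functional [alpha z + r beta]; the Slater point [xhat] ensures
    [beta > 0], and the multiplier is [alpha / beta]. *)
Lemma lagrange_multiplier (p : E -> R) (xbar xhat : E) :
  convex_function X (p : E -> R^o) ->
  X xbar -> K (- h xbar) -> (forall x, X x -> K (- h x) -> p xbar <= p x) ->
  X xhat -> interior K (- h xhat) ->
  exists u : dual_space Z, [/\ dual_cone K u, u (h xbar) = 0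
    & forall x, X x -> p xbar <= p x + u (h x)].
Proof.
move=> p_convex Xbar Kbar pmin Xhat Khat; have [K0 Kz Kd] := K_cone.
pose Kp : set (Z * R^o)%type := [set w | K w.1 /\ 0 <= w.2].
pose A : set (Z * R^o)%type := [set (h x, p x - p xbar : R^o) | x in X].
(* The Slater point makes [e] an order unit for [Kp], and the normalization [phi e = 1] later
   excludes [beta = 0]. *)
pose e : (Z * R^o)%type := (- h xhat, 1).
have Kp_cone : convex_cone Kp.
  split => [|t w t0 [w1 w2]|v w [v1 v2] [w1 w2]].
  - by split.
  - by split; [exact: Kz|exact: mulr_ge0].
  - by split; [exact: Kd|exact: addr_ge0].
have e_unit w : exists2 s : R, 0 < s & Kp (e + s *: w).
  have [s s0 Ks] := interior_order_unit w.1 Khat.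
  have w2 : 0 < `|w.2| + 1 by rewrite ltr_wpDl.
  (* The bound [m <= s] keeps the first component in [K], as a convex combination of
     [- h xhat + s w.1] and [- h xhat]; the other bound keeps [1 + m w.2] nonnegative. *)
  pose m := Num.min s (`|w.2| + 1)^-1.
  have m0 : 0 < m by rewrite lt_min s0 invr_gt0.
  have ms : m / s <= 1 by rewrite ler_pdivrMr// mul1r ge_min lexx.
  exists m => //; split => /=.
    have -> : - h xhat + m *: w.1 =
        (m / s) *: (- h xhat + s *: w.1) + (1 - m / s) *: - h xhat.
      rewrite scalerDr scalerA divfK ?gt_eqF// addrAC -scalerDl.
      by rewrite [m / s + _]addrC subrK scale1r.
    apply: (Kd); first by apply: (Kz) => //; rewrite divr_ge0// ltW.
    by apply: (Kz); [rewrite subr_ge0|exact: interior_subset].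
  have : m * (`|w.2| + 1) <= 1.
    by rewrite -ler_pdivlMr// mul1r ge_min lexx orbT.
  have : m * - w.2 <= m * `|w.2| by rewrite ler_pM2l// -normrN ler_norm.
  rewrite /GRing.scale /=; lra.
have [| | |phi [phie phiK phiA]] := convex_separation (A := A) Kp_cone e_unit.
- by exists (h xbar, p xbar - p xbar), xbar.
- move=> _ _ t [x Xx <-] [y Xy <-] t01; pose z := t *: x + (1 - t) *: y.
  exists (h z, p z - p xbar); first by exists z => //; exact: convex_setP.
  split => /=; first exact: h_convex.
  have := convex_functionP p_convex Xx Xy t01; rewrite -/z /GRing.scale /=; lra.
(* A common point would give a feasible [x] with [p x <= p xbar - t], against the minimality of
   [xbar]. *)
- move=> _ t [x Xx <-] t0 [/= Kx px].
  have /(pmin x Xx) : K (- h x).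
    have := Kd _ _ Kx (Kz t _ (ltW t0) (interior_subset Khat)).
    by rewrite opprD addrNK.
  by move: px; rewrite /GRing.scale /= mulr1; lra.
pose alpha z := phi (z, 0); pose beta := phi (0, 1).
have phiE z r : phi (z, r) = alpha z + r * beta.
  have -> : (z, r) = (z, 0) + r *: (0, 1) :> (Z * R^o)%type.
    by congr (_, _); rewrite /= ?scaler0 ?addr0 ?add0r// /GRing.scale /= mulr1.
  by rewrite linearD linearZ.
have alphaK z : K z -> 0 <= alpha z by move=> Kz'; apply: phiK; split.
have beta_ge0 : 0 <= beta by apply: phiK; split.
have alpha_lin : linear (alpha : Z -> R^o).
  move=> a v w; rewrite /alpha -linearP; congr (phi (_, _)).
  by rewrite /= scaler0 addr0.
pose alphaL := GRing.isLinear.Build R Z R^o _ (alpha : Z -> R^o) alpha_lin.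
pose alpha' : {linear Z -> R^o} := HB.pack (alpha : Z -> R^o) alphaL.
have lagr x : X x -> 0 <= alpha (h x) + (p x - p xbar) * beta.
  by move=> Xx; rewrite -phiE; apply: phiA; exists x.
(* If [beta = 0], then [phi e = 1] says [alpha (h xhat) = -1], while [lagr] at [xhat] says
   [alpha (h xhat) >= 0]. *)
have beta_gt0 : 0 < beta.
  rewrite lt_def beta_ge0 andbT; apply/eqP => beta0.
  have := lagr _ Xhat; move: phie; rewrite phiE.
  have -> : alpha (- h xhat) = - alpha (h xhat) by exact: (linearN alpha').
  rewrite beta0; lra.
have [u0 u0E] : exists u : dual_space Z, forall z, u z = alpha z.
  have alphaC := positive_linear_continuous (phi := alpha') Khat alphaK.
  by exists (DualSpace alphaC).
have [u uE] := dual_scale u0 beta^-1.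
have uK : dual_cone K u.
  move=> z Kz'; rewrite uE u0E; apply: mulr_ge0; last exact: alphaK.
  by rewrite invr_ge0.
have dual x : X x -> p xbar <= p x + u (h x).
  move=> /lagr lx; rewrite -subr_ge0 uE u0E.
  have -> : p x + beta^-1 * alpha (h x) - p xbar =
      beta^-1 * (alpha (h x) + (p x - p xbar) * beta).
    by field; rewrite gt_eqF.
  by rewrite mulr_ge0// invr_ge0.
(* Complementary slackness: [dual] at [xbar] gives [u (h xbar) >= 0], and [- h xbar] in [K] gives
   the converse. *)
exists u; split => //; apply/eqP; rewrite eq_le.
have := dual _ Xbar; rewrite lerDl => ->; rewrite andbT.
by have := uK _ Kbar; rewrite linearN oppr_ge0.
Qed.

End ConvexProgram.

Lemma finite_argmin {R : realType} {T : eqType} (A : set T) (h : T -> R) :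
  finite_set A -> A !=set0 -> exists2 a, A a & forall b, A b -> h a <= h b.
Proof.
move=> /finite_seqP[s ->] [a /= sa]; elim: s a sa => // b s IH a _.
have [->|[c cs]] : s = [::] \/ exists c, c \in s.
- by case: s {IH} => [|c s]; [left|right; exists c; rewrite mem_head].
- by exists b => [|d]; rewrite /= ?mem_seq1// => /eqP->.
have [d /= ds dmin] := IH _ cs; have [bd|db] := leP (h b) (h d).
  exists b => [|x]; rewrite /= ?mem_head// inE => /predU1P[->//|/dmin].
  exact: le_trans.
exists d => [|x]; rewrite /= ?inE ?ds ?orbT// => /predU1P[->|/dmin//].
exact: ltW.
Qed.

(** * Transitions of the algorithm and the effect of cuts *)

Section Benders.
Context {R : realType} {E Z D : normedModType R}.
Variables (X : set E) (Y : set D) (K : set Z).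
Variables (f : E -> D -> R) (g : E -> D -> Z).
Implicit Types (y : D) (u z : dual_space Z) (s : @gbd_state R Z) (eta : R).
Local Notation execution := (gbd_execution X Y K f g).
Local Notation step := (gbd_step X Y K f g).

(** An execution may stand still only where no step exists, so exhibiting one admissible step,
    whichever it is, shows that the execution moves. *)
Lemma step_progress eps (c : nat -> @gbd_config R Z D) n c' :
  execution eps c -> step eps (c n) c' -> step eps (c n) (c n.+1).
Proof. by move=> /(_ n)[//|[_ stuck]] /stuck. Qed.

Lemma step1_inv eps y1 z1 c : step eps (Step1 y1 z1) c ->
  exists u1, c = Step2 (gbd_initial X K f g y1 u1 z1).
Proof.
move eqc : (Step1 y1 z1) => c0 st; case: st eqc => // ? ? u1 _ [<- <-].
by exists u1.
Qed.

Lemma step2_inv eps s c : step eps (Step2 s) c ->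
  c = Stopped \/
  exists y eta, master_optimal X Y f g s y eta /\ c = Step3 s y eta.
Proof.
move eqc : (Step2 s) => c0 st; case: st eqc => //; first by left.
by move=> s' y eta smaster _ [->]; right; exists y, eta.
Qed.

(** Both ways of continuing give [value y > eta]: one because [eps > 0], the other because the value
    is infinite. This is what contradicts a return to a parameter already cut off. *)
Lemma step3_inv eps s y eta c : 0 < eps -> step eps (Step3 s y eta) c ->
  c = Stopped \/ ~ (value X K f g y <= eta%:E)%E /\
    ((exists2 u, optimal_multiplier X K f g y u &
       c = Step2 (add_optimality_cut X K f g s y u)) \/
     (exists z, [/\ dual_cone K z, (0 < constraint_inf X g z y)%E &
       c = Step2 (add_feasibility_cut s z)])).
Proof.
move=> eps0; move eqc : (Step3 s y eta) => c0 st; case: st eqc => //.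
- by left.
- move=> s' y' eta' u _ vy uy [-> -> ->]; right; split; last by left; exists u.
  move=> vy'; apply: vy; apply: (le_trans vy').
  by rewrite lee_fin lerDl ltW.
- move=> s' y' eta' z vy zK _ zy [-> -> ->]; right.
  by split; [rewrite vy leye_eq|right; exists z].
Qed.

Definition cut_off s y :=
  (exists2 i, gbd_T s i & optimal_multiplier X K f g y (gbd_u s i)) \/
  (exists2 j, gbd_S s j & (0 < constraint_inf X g (gbd_z s j) y)%E).

(** At a multiplier optimal for [y] the Lagrangian infimum is at least [f xbar y], and the
    optimality cut bounds that infimum by [eta]. A feasibility cut violated at [y] contradicts
    master feasibility. *)
Lemma value_cut_off s y eta : master_feasible X Y f g s y eta -> cut_off s y ->
  (value X K f g y <= eta%:E)%E.
Proof.
move=> [_ sT sS] [[i /sT si [xbar Xxbar [xmin ux _ gx]]]|[j /sS + sj]].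
  apply: (@le_trans _ _ (f xbar y)%:E).
    by apply: ereal_inf_lbound; exists xbar.
  apply: le_trans si; apply: le_ereal_inf_tmp => _ [x Xx <-].
  by rewrite lee_fin -[f xbar y]addr0 -ux; exact: xmin.
by rewrite leNgt sj.
Qed.

(** The bounds by [gbd_k] make the index of the next cut fresh, so earlier cuts are never
    overwritten. The remaining clauses serve the solvability of the master problem. *)
Definition valid_state s :=
  [/\ finite_set (gbd_T s), gbd_T s 1%N,
      forall i, gbd_T s i -> (i <= gbd_k s)%N,
      forall j, gbd_S s j -> (j <= gbd_k s)%N
    & forall j, gbd_S s j -> dual_cone K (gbd_z s j)].

Lemma valid_initial y1 u1 z1 : dual_cone K z1 ->
  valid_state (gbd_initial X K f g y1 u1 z1).
Proof. by move=> z1K; split => //= i ->. Qed.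

Lemma valid_optimality_cut s y u : valid_state s ->
  valid_state (add_optimality_cut X K f g s y u).
Proof.
move=> [Tfin T1 Tk Sk SK]; split => //=.
- by rewrite finite_setU; split.
- by left.
- by move=> i [/Tk/leqW|->].
- by move=> j /Sk/leqW.
Qed.

Lemma valid_feasibility_cut s z : dual_cone K z -> valid_state s ->
  valid_state (add_feasibility_cut s z).
Proof.
move=> zK [Tfin T1 Tk Sk SK]; split => //=.
- by move=> i /Tk/leqW.
- by move=> j [/Sk/leqW|->].
- by move=> j; case: eqP => [//|jk] [/SK//|].
Qed.

Lemma cut_off_optimality_cut s y u y' : valid_state s ->
  optimal_multiplier X K f g y u -> cut_off s y' \/ y' = y ->
  cut_off (add_optimality_cut X K f g s y u) y'.
Proof.
move=> [_ _ Tk _ _] uy [[[i Ti ui]|[j Sj zj]]|->]; last 2 first.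
- by right; exists j.
- by left; exists (gbd_k s).+1; [right|rewrite /= eqxx].
left; exists i; first by left.
by rewrite /= ltn_eqF// ltnS; exact: Tk.
Qed.

Lemma cut_off_feasibility_cut s y z y' : valid_state s ->
  (0 < constraint_inf X g z y)%E -> cut_off s y' \/ y' = y ->
  cut_off (add_feasibility_cut s z) y'.
Proof.
move=> [_ _ _ Sk _] zy [[[i Ti ui]|[j Sj zj]]|->]; first by left; exists i.
- right; exists j; first by left.
  by rewrite /= ltn_eqF// ltnS; exact: Sk.
- by right; exists (gbd_k s).+1; [right|rewrite /= eqxx].
Qed.

(** * Existence of the objects that each step requires, and termination *)

Hypothesis X_convex : convex_set X.
Hypothesis X_compact : compact X.
Hypothesis K_closed : closed K.
Hypothesis K_cone : convex_cone K.
Hypothesis K_interior : interior K !=set0.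
Hypothesis f_convex : forall y, Y y -> convex_function X (fun x => f x y : R^o).
Hypothesis g_convex : forall y, Y y -> cone_convex K X (fun x => g x y).
Hypothesis f_continuous :
  forall y, Y y -> {within X, continuous (fun x => f x y)}.
Hypothesis g_continuous :
  forall y, Y y -> {within X, continuous (fun x => g x y)}.
Hypothesis slater : forall y, feasible_params X Y K g y ->
  exists2 xhat, X xhat & prec K (g xhat y) 0.
Hypothesis Y_finite : finite_set Y.
Hypothesis V_nonempty : feasible_params X Y K g !=set0.

Let X_nonempty : X !=set0.
Proof. by have [y [_ [x [Xx _]]]] := V_nonempty; exists x. Qed.

Lemma feasible_set_compact y : Y y -> compact (feasible_set X K g y).
Proof.
move=> Yy.
have negK : closed [set w : Z | K (0 - w)].
  by apply: preimage_closed K_closed => w _; apply: cvgB;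
    [exact: cvg_cst|exact: cvg_id].
(* Continuity holds only within [X], so the preimage is closed in the subspace, that is, it agrees
   on [X] with a closed set [V]. *)
have /continuous_closedP/(_ _ negK)/closed_subspaceP[V clV VX] :=
  g_continuous Yy.
have -> : feasible_set X K g y = X `&` V by rewrite setIC VX setIC.
exact: compact_closedI.
Qed.

(** A finite value makes the compact feasible set nonempty, so the minimum is attained and the
    Slater condition applies. *)
Lemma optimal_multiplier_exists y : Y y -> (value X K f g y < +oo)%E ->
  exists u, optimal_multiplier X K f g y u.
Proof.
move=> Yy vy; have Fy : feasible_set X K g y !=set0.
  apply: contrapT => /set0P/negP; rewrite negbK => /eqP Fy.
  by move: vy; rewrite /value Fy image_set0 ereal_inf0.
have [xhat Xhat Khat] := slater (conj Yy Fy).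
have fF : {within feasible_set X K g y, continuous (fun x => f x y)}.
  by apply: continuous_subspaceW (f_continuous Yy) => x [].
have [xbar + xmin] := compact_EVT_min Fy (feasible_set_compact Yy) fF.
rewrite inE => -[Xbar Kbar].
have [|x Xx Kx||u [uK ux udual]] := @lagrange_multiplier _ _ _ X K
  (fun x => g x y) X_convex K_cone (g_convex Yy) (fun x => f x y) xbar xhat
  (f_convex Yy) Xbar _ _ Xhat.
- by move: Kbar; rewrite /preceq sub0r.
- by apply: xmin; rewrite inE; split => //; rewrite /preceq sub0r.
- by move: Khat; rewrite /prec sub0r.
by exists u, xbar => //; split => //; rewrite ux addr0.
Qed.

Lemma infeasible_multiplier_exists y : Y y -> value X K f g y = +oo%E ->
  exists z,
    [/\ dual_cone K z, dual_norm z = 1 & (0 < constraint_inf X g z y)%E].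
Proof.
move=> Yy vy.
have [|z [zK z1 [d d0 zd]]] := @infeasibility_certificate _ _ _ X K
    (fun x => g x y) X_nonempty X_convex K_cone (g_convex Yy) X_compact K_closed
    K_interior (g_continuous Yy).
  move=> x Xx Kx; have : (value X K f g y <= (f x y)%:E)%E.
    apply: ereal_inf_lbound; exists x => //; split => //.
    by rewrite /preceq sub0r.
  by rewrite vy leye_eq.
exists z; split => //; apply: (@lt_le_trans _ _ d%:E); first by rewrite lte_fin.
by apply: le_ereal_inf_tmp => _ [x Xx <-]; rewrite lee_fin; exact: zd.
Qed.

(** Needed because the master variable [eta] is a real number that has to attain the largest cut. *)
Lemma lagrangian_inf_fin u y : Y y -> lagrangian_inf X f g u y \is a fin_num.
Proof.
move=> Yy.
have cont : {within X, continuous (fun x => f x y + u (g x y))}.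
  move=> x; apply: cvgD; first exact: f_continuous.
  have uc : {for g x y, continuous (u : Z -> R)} by exact: dual_continuous.
  apply: (@cvg_comp _ _ _ (fun x => g x y) u _ _ _ _ uc).
  exact: g_continuous.
have [xbar + xmin] := compact_EVT_min X_nonempty X_compact cont.
rewrite inE => Xbar.
have -> : lagrangian_inf X f g u y = (f xbar y + u (g xbar y))%:E.
  apply/eqP; rewrite eq_le; apply/andP; split.
    by apply: ereal_inf_lbound; exists xbar.
  apply: le_ereal_inf_tmp => _ [x Xx <-]; rewrite lee_fin; apply: xmin.
  by rewrite inE.
by [].
Qed.

(** For fixed [y] the least [eta] is a maximum over the finite nonempty [gbd_T s]; it remains to
    minimize over the finite set [M]. *)
Lemma master_optimal_exists s : valid_state s ->
  exists y eta, master_optimal X Y f g s y eta.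
Proof.
move=> [Tfin T1 _ _ SK].
pose L y i := fine (lagrangian_inf X f g (gbd_u s i) y).
have LE y i : Y y -> lagrangian_inf X f g (gbd_u s i) y = (L y i)%:E.
  by move=> Yy; rewrite fineK//; exact: lagrangian_inf_fin.
pose M := [set y | Y y /\
  forall j, gbd_S s j -> (constraint_inf X g (gbd_z s j) y <= 0)%E].
(* A parameter in [V] passes every feasibility cut, since functionals in the dual cone are
   nonpositive at a feasible [g x y]. *)
have M_nonempty : M !=set0.
  have [y [Yy [x [Xx Kx]]]] := V_nonempty; exists y; split => // j Sj.
  apply: (@le_trans _ _ (gbd_z s j (g x y))%:E).
    by apply: ereal_inf_lbound; exists x.
  have := SK _ Sj _ Kx; rewrite sub0r linearN oppr_ge0 => zx.
  by rewrite lee_fin.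
have M_finite : finite_set M by apply: sub_finite_set Y_finite => y [].
have imax y : exists i, gbd_T s i /\ forall j, gbd_T s j -> L y j <= L y i.
  have [i Ti imax] := finite_argmin (fun i => - L y i) Tfin (ex_intro _ _ T1).
  by exists i; split => // j /imax; rewrite lerN2.
have /choice[top topP] := imax.
have [y My ymin] := finite_argmin (fun y => L y (top y)) M_finite M_nonempty.
exists y, (L y (top y)); split.
  have [Yy Sy] := My; split => // i Ti.
  by rewrite LE// lee_fin; apply: (topP y).2.
move=> y' eta' [Yy' Ty' Sy']; apply: (le_trans (ymin y' _)); first by split.
by have := Ty' _ (topP y').1; rewrite LE.
Qed.

(** Induction on the size of [l], a list containing every parameter not yet cut off: each round of
    Steps 2 and 3 that does not stop removes its [y] from [l]. *)
Lemma stops_from_step2 eps (c : nat -> gbd_config) (l : seq D) s m : 0 < eps ->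
  execution eps c -> c m = Step2 s -> valid_state s ->
  (forall y, Y y -> y \in l \/ cut_off s y) -> exists n, c n = Stopped.
Proof.
move=> eps0 ex; have [n] := ubnP (size l).
elim: n => // n IH in l s m *; rewrite ltnS => ln cm sv sl.
have /step2_inv[|[y [eta [syeta cSm]]]] : step eps (Step2 s) (c m.+1).
- rewrite -cm; have [y [eta syeta]] := master_optimal_exists sv.
  have [ub|ub] := pselect (gbd_UBD s <= (eta + eps)%:E)%E.
    apply: (@step_progress _ _ _ Stopped ex); rewrite cm.
    exact: step_master_stop syeta ub.
  apply: (@step_progress _ _ _ (Step3 s y eta) ex); rewrite cm.
  exact: step_master.
- by exists m.+1.
have [Yy _ _] := syeta.1.
have : step eps (Step3 s y eta) (c m.+2).
  rewrite -cSm; have [vy|vy] := eqVneq (value X K f g y) +oo%E.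
    have [z [zK z1 zy]] := infeasible_multiplier_exists Yy vy.
    apply: (@step_progress _ _ _ (Step2 (add_feasibility_cut s z)) ex).
    by rewrite cSm; exact: step_infeasible.
  have {}vy : (value X K f g y < +oo)%E by rewrite ltey.
  have [vle|vle] := pselect (value X K f g y <= (eta + eps)%:E)%E.
    apply: (@step_progress _ _ _ Stopped ex).
    by rewrite cSm; exact: step_primal_stop.
  have [u uy] := optimal_multiplier_exists Yy vy.
  apply: (@step_progress _ _ _ (Step2 (add_optimality_cut X K f g s y u)) ex).
  by rewrite cSm; exact: step_primal.
move=> /(step3_inv eps0)[|[vy next]]; first by exists m.+2.
(* Were [y] already cut off, its value would be at most [eta] and Step 3 would have stopped. *)
have yl : y \in l.
  by have [//|/(value_cut_off syeta.1)] := sl _ Yy.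
have ll : (size [seq x <- l | x != y] < n)%N.
  rewrite (leq_trans _ ln)// size_filter -(count_predC (pred1 y) l) -add1n.
  by rewrite leq_add2r -has_count has_pred1.
have yl' y' : Y y' -> y' \in [seq x <- l | x != y] \/ (cut_off s y' \/ y' = y).
  move=> /sl[y'l|]; last by right; left.
  by have [->|y'y] := eqVneq y' y; [right; right|left]; rewrite ?mem_filter ?y'y.
case: next => [[u uy cn]|[z [zK zy cn]]].
  apply: (IH _ _ _ ll cn (valid_optimality_cut y u sv)) => y' /yl'[|].
    by left.
  by right; exact: cut_off_optimality_cut.
apply: (IH _ _ _ ll cn (valid_feasibility_cut zK sv)) => y' /yl'[|].
  by left.
by right; exact: cut_off_feasibility_cut zy _.
Qed.

End Benders.

Theorem theorem4p5 (R : realType) (E Z : completeNormedModType R)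
  (D : normedModType R) (X : set E) (Y : set D) (K : set Z)
  (f : E -> D -> R) (g : E -> D -> Z)
  (X_closed : closed X) (X_convex : convex_set X)
  (K_closed : closed K) (K_convex : convex_set K) (K_cone : cone K)
  (K_interior : interior K !=set0)
  (f_convex : forall y, Y y -> convex_function X (fun x => f x y : R^o))
  (g_convex : forall y, Y y -> cone_convex K X (fun x => g x y))
  (g_continuous : forall y, Y y -> {within X, continuous (fun x => g x y)})
  (slater : forall y, feasible_params X Y K g y ->
     exists2 xhat, X xhat & prec K (g xhat y) 0)
  (X_compact : compact X)
  (Y_finite : finite_set Y)
  (f_continuous : forall y, Y y -> {within X, continuous (fun x => f x y)}) :
  forall eps : R, 0 < eps -> gbd_terminates X Y K f g eps.
Proof.
move=> eps eps0 y1 z1 Vy1 z1K _ c c0 ex.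
have KC : convex_cone K.
  apply: convex_cone_set => //.
  by have [e /interior_subset] := K_interior; exists e.
(* The induction starts with a list of all of [Y], no parameter being assumed cut off. *)
have [l lY] := (finite_seqP Y).1 Y_finite.
have [u1 c1] : exists u1, c 1%N = Step2 (gbd_initial X K f g y1 u1 z1).
  have [|u1 u1y1] := optimal_multiplier_exists X_convex X_compact K_closed KC
      f_convex g_convex f_continuous g_continuous slater Vy1.1.
    have [_ [x Fx]] := Vy1; apply: (@le_lt_trans _ _ (f x y1)%:E).
      by apply: ereal_inf_lbound; exists x.
    exact: ltry.
  apply: (@step1_inv _ _ _ _ X Y K f g eps); rewrite -c0.
  apply: (step_progress ex); rewrite c0; exact: step_init u1y1.
apply: (stops_from_step2 X_convex X_compact K_closed KC K_interior f_convex
  g_convex f_continuous g_continuous slater Y_finite (ex_intro _ _ Vy1) (l := l)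
  eps0 ex c1 (valid_initial X f g y1 u1 z1K)) => y.
by rewrite lY; left.
Qed.
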